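(* Let $R$ be a ring. Then the following are equivalent: (1) $R$ is a strongly $J$-clean ring. (2) $R$ is a strongly quasi-nil-clean ring. (3) $R$ is a strongly $\Delta$-nil-clean ring.
   Context: All rings are associative with identity, not necessarily commutative. $J(R)$ denotes the Jacobson radical of $R$ and $U(R)$ the group of units. $QN(R)$ is the set of quasi-nilpotent elements: those $a\in R$ such that $1-ax$ is invertible for every $x\in R$ with $xa=ax$. $\Delta N(R)$ is the set of $\Delta$-nilpotent elements: those $a\in R$ such that $1-au$ is invertible for every $u\in U(R)$ with $au=ua$. A ring $R$ is strongly $J$-clean (respectively strongly quasi-nil-clean, strongly $\Delta$-nil-clean) if every $a\in R$ can be written $a=e+q$ with $e^2=e\in R$, $eq=qe$ and $q\in J(R)$ (respectively $q\in QN(R)$, $q\in\Delta N(R)$). *)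

(* Defs.v *)
From mathcomp Require Import all_boot all_algebra.
From mathcomp Require Import classical_sets.

Set Implicit Arguments.
Unset Strict Implicit.
Unset Printing Implicit Defensive.

Import GRing.Theory.
Local Open Scope ring_scope.
Local Open Scope classical_set_scope.

Section StronglyClean.

(* [pzRingType]: associative rings with identity, not necessarily commutative;
   the zero ring is allowed. *)
Variable R : pzRingType.

(* Two-sided invertibility; [GRing.unit] needs a [unitRingType], i.e. a nonzero
   ring with a chosen inverse operation. *)
Definition units : set R :=
  [set u | exists v : R, u * v = 1 /\ v * u = 1].

(* The ideals of [ring_quotient] are boolean predicates on nonzero rings and
   are proper by definition, hence this definition. *)
Definition left_ideal (I : set R) : Prop :=
  [/\ I 0,
      forall x y : R, I x -> I y -> I (x + y)
    & forall r x : R, I x -> I (r * x)].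

Definition maximal_left_ideal (M : set R) : Prop :=
  [/\ left_ideal M,
      M <> setT
    & forall I : set R, left_ideal I -> M `<=` I -> I = M \/ I = setT].

Definition jacobson_radical : set R :=
  \bigcap_(M in [set M : set R | maximal_left_ideal M]) M.

Definition quasi_nilpotents : set R :=
  [set a | forall x : R, x * a = a * x -> units (1 - a * x)].

Definition Delta_nilpotents : set R :=
  [set a | forall u : R, units u -> a * u = u * a -> units (1 - a * u)].

Definition strong_decomposition (S : set R) : Prop :=
  forall a : R, exists e q : R,
    [/\ a = e + q, e ^+ 2 = e, e * q = q * e & S q].

Definition strongly_J_clean : Prop :=
  strong_decomposition jacobson_radical.

Definition strongly_quasi_nil_clean : Prop :=
  strong_decomposition quasi_nilpotents.

Definition strongly_Delta_nil_clean : Prop :=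
  strong_decomposition Delta_nilpotents.

End StronglyClean.

Arguments strongly_J_clean : clear implicits.
Arguments strongly_quasi_nil_clean : clear implicits.
Arguments strongly_Delta_nil_clean : clear implicits.

(* Main.v *)
Require Import Defs.
From mathcomp Require Import all_boot all_algebra.
From mathcomp Require Import boolp classical_sets.

(** The radical J consists of quasi-nilpotent elements, and quasi-nilpotent
    elements are Delta-nilpotent, so the point is that a strongly
    Delta-nil-clean ring R is strongly J-clean. If q is Delta-nilpotent then
    1 + q is a unit, so it is enough that every unit lies in 1 + J
    ([unit_sub1_jacobson]).

    Two consequences of strong Delta-nil-cleanness are used throughout. First,
    u - 1 is Delta-nilpotent for every unit u; hence if u is a unit, v is a unit
    commuting with u, and (u - 1) v is idempotent, then (u - 1) v = 0
    ([unit_sub1_Delta_nilpotent], [Delta_nilpotent_idempotent]). Secondly, R is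
    an exchange ring: every element outside J has a left multiple which is a
    nonzero idempotent ([exchange_idempotent]).

    The first fact forbids 2 x 2 matrix units in R, since the Fibonacci matrix
    u satisfies (u - 1) u = 1 ([no_matrix_units]). By the exchange property, an
    element of square zero outside J would produce such matrix units; so J
    contains all elements of square zero ([square_zero_jacobson]), in particular
    all e y (1 - e) with e idempotent. Idempotents are therefore central modulo
    J, and R is Dedekind finite.

    Now let u be a unit with q = u - 1 outside J, and let e = r q be a nonzero
    idempotent. As e is central modulo J, both e u e and e q e are units of the
    corner ring e R e, and they differ by its identity e. This contradicts the
    first fact, applied to the unit 1 - e + e u e of R. *)

Set Implicit Arguments.
Unset Strict Implicit.
Unset Printing Implicit Defensive.

Import GRing.Theory.
Local Open Scope ring_scope.
Local Open Scope classical_set_scope.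

(** * The Jacobson radical *)

Section Jacobson.

Variable R : pzRingType.
Implicit Types a c e r s t u v w x y : R.

Lemma left_ideal_full (K : set R) : left_ideal K -> K 1 -> K = setT.
Proof.
move=> [_ _ KM] K1; apply/seteqP; split=> // y _.
by rewrite -[y]mulr1; exact: KM.
Qed.

(** Krull's theorem for the left ideal [R x], by Zorn's lemma. The chain
    condition is imposed on [Rx `|` A] rather than on [A], so that the union of
    the empty chain needs no separate treatment. *)
Lemma maximal_left_ideal_containing x : ~ (exists c, c * x = 1) ->
  exists2 M : set R, maximal_left_ideal M & M x.
Proof.
move=> xNinv; pose I : set R := [set y | exists r, y = r * x].
pose P (A : set R) := left_ideal (I `|` A) /\ ~ (I `|` A) 1.
have [F FP Ftot|A [[Aid A1] Amax]] := @Zorn_bigcup _ P.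
  set U := \bigcup_(X in F) X.
  have lift A y : F A -> (I `|` A) y -> (I `|` U) y.
    by move=> FA [|Ay]; [left|right; exists A].
  have grow A y : F A -> (I `|` U) y ->
      exists2 B, F B & A `<=` B /\ (I `|` B) y.
    move=> FA [Iy|[B FB By]]; first by exists A => //; split=> //; left.
    have [AB|BA] := Ftot _ _ FA FB; first by exists B => //; split=> //; right.
    by exists A => //; split=> //; right; apply: BA.
  split; last first.
    case=> [[c c1]|[A FA A1]]; first by apply: xNinv; exists c.
    by have [_ +] := FP _ FA; apply; right.
  split=> [|y z Uy Uz|r y].
  - by left; exists 0; rewrite mul0r.
  - have [[A FA]|F0] := pselect (exists A, F A).
      have [B FB [_ By]] := grow _ _ FA Uy.
      have [C FC [BC Cz]] := grow _ _ FB Uz.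
      apply: (lift C) => //; have [[_ CD _] _] := FP _ FC.
      by apply: CD => //; case: By => [|/BC]; [left|right].
    have UI w : (I `|` U) w -> I w by case=> // -[A FA]; case: F0; exists A.
    have [[b ->] [c ->]] := (UI _ Uy, UI _ Uz).
    by left; exists (b + c); rewrite mulrDl.
  - case=> [[b ->]|[A FA Ay]]; first by left; exists (r * b); rewrite mulrA.
    by apply: (lift A) => //; have [[_ _ +] _] := FP _ FA; apply; right.
exists (I `|` A); last by left; exists 1; rewrite mul1r.
split=> // [AT|K Kid AK]; first by apply: A1; rewrite AT.
have [K1|K1] := pselect (K 1); first by right; exact: left_ideal_full.
left; apply/seteqP; split=> // y Ky; right; apply: contrapT => Ay.
have IK : I `|` K = K by apply/setUidPr => z Iz; apply: AK; left.
apply: (Amax K); last by rewrite /P IK.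
by split=> [z Az|KA]; [apply: AK; right|apply: Ay; exact: KA].
Qed.

(** A maximal left ideal [M] misses [a] exactly when [M + R a] contains [1],
    that is, when [M] contains some [1 - r a]; and an element lies in some
    maximal left ideal if and only if it is not left invertible. *)
Lemma jacobson_radicalP a :
  jacobson_radical a <-> forall r, exists c, c * (1 - r * a) = 1.
Proof.
split=> [Ja r|aP M [Mid MT Mmax]].
  apply: contrapT => /maximal_left_ideal_containing[M Mmax Mx].
  have [Mid MT _] := Mmax; have [_ MD MM] := Mid; apply: MT.
  apply: left_ideal_full => //; rewrite -[1](subrK (r * a)).
  by apply: MD => //; apply: MM; exact: Ja.
have [M0 MD MM] := Mid; apply: contrapT => Ma.
pose K := [set y | exists2 m, M m & exists r, y = m + r * a].
have Kid : left_ideal K.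
  split=> [|y z [m Mm [r ->]] [n Mn [s ->]]|t y [m Mm [r ->]]].
  - by exists 0 => //; exists 0; rewrite mul0r addr0.
  - by exists (m + n); [exact: MD|exists (r + s); rewrite mulrDl addrACA].
  - by exists (t * m); [exact: MM|exists (t * r); rewrite mulrDr mulrA].
have [||KM|KT] := Mmax K => //.
- by move=> m Mm; exists m => //; exists 0; rewrite mul0r addr0.
- by apply: Ma; rewrite -KM; exists 0 => //; exists 1; rewrite add0r mul1r.
have [m Mm [r m1]] : K 1 by rewrite KT.
have [c c1] := aP r; apply: MT; apply: left_ideal_full => //.
by rewrite -c1; apply: MM; rewrite m1 addrK.
Qed.

Lemma jacobson_radicalMl r a : jacobson_radical a -> jacobson_radical (r * a).
Proof. by move=> Ja M Mmax; have [[_ _ +] _ _] := Mmax; apply; exact: Ja. Qed.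

(** Left invertibility of [1 - y x] passes to [1 - x y]: if [c] inverts the
    former then [1 + x c y] inverts the latter. *)
Lemma jacobson_radicalMr a s : jacobson_radical a -> jacobson_radical (a * s).
Proof.
move=> /jacobson_radicalP aP; apply/jacobson_radicalP => r.
have [c c1] := aP (s * r); exists (1 + r * a * c * s).
have -> : (1 + r * a * c * s) * (1 - r * (a * s)) =
    1 - r * a * s + r * a * (c * (1 - s * r * a)) * s.
  by rewrite mulrDl mul1r !mulrBr !mulrBl !mulr1 !mulrA.
by rewrite c1 mulr1 subrK.
Qed.

Lemma jacobson_radical_unit a : jacobson_radical a -> units (1 - a).
Proof.
move=> /jacobson_radicalP aP.
have [c] := aP 1; rewrite mul1r => c1.
(* [c = 1 + c a] is itself of the form [1 - r a], hence has a left inverse. *)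
have [d] := aP (- c); rewrite mulNr opprK.
have -> : 1 + c * a = c by rewrite -c1 mulrBr mulr1 subrK.
move=> d1; exists c; split=> //.
suff -> : 1 - a = d by [].
by rewrite -[RHS]mulr1 -[in RHS]c1 mulrA d1 mul1r.
Qed.

Lemma jacobson_radical_idempotent e : jacobson_radical e -> e * e = e -> e = 0.
Proof.
move=> /jacobson_radical_unit[c [_ c1]] ee.
by rewrite -[e]mul1r -c1 -mulrA mulrBl mul1r ee subrr mulr0.
Qed.

Lemma jacobson_sub_quasi_nilpotents :
  @jacobson_radical R `<=` @quasi_nilpotents R.
Proof.
by move=> a Ja x _; apply: jacobson_radical_unit; exact: jacobson_radicalMr.
Qed.

Lemma quasi_sub_Delta_nilpotents :
  @quasi_nilpotents R `<=` @Delta_nilpotents R.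
Proof. by move=> a aQ u _ au; exact: aQ (esym au). Qed.

Lemma strong_decomposition_sub (S T : set R) :
  S `<=` T -> strong_decomposition S -> strong_decomposition T.
Proof.
move=> ST SD a; have [e [q [? ? ? Sq]]] := SD a.
by exists e, q; split=> //; exact: ST.
Qed.

End Jacobson.

(** * Units and Delta-nilpotent elements *)

Section DeltaNilpotent.

Variable R : pzRingType.
Implicit Types a b c d e q r s t u v w x y : R.

Lemma units1 : units (1 : R). Proof. by exists 1; rewrite mulr1. Qed.

Lemma unitsN1 : units (-1 : R).
Proof. by exists (-1); rewrite mulrNN mulr1. Qed.

Lemma Delta_nilpotent_unitB q : Delta_nilpotents q -> units (1 - q).
Proof. by move=> /(_ _ units1); rewrite mulr1 mul1r; exact. Qed.

Lemma Delta_nilpotent_unitD q : Delta_nilpotents q -> units (1 + q).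
Proof. by move=> /(_ _ unitsN1); rewrite mulrN1 mulN1r opprK; exact. Qed.

Lemma commute_unit_inv q u v : u * v = 1 -> v * u = 1 -> q * u = u * q ->
  q * v = v * q.
Proof.
move=> uv vu qu.
by rewrite -[LHS]mul1r -vu -mulrA (mulrA u) -qu -!mulrA uv mulr1.
Qed.

(** [1 - q v] is a unit and an idempotent with complement [q v]. *)
Lemma Delta_nilpotent_idempotent q v g : Delta_nilpotents q -> units v ->
  q * v = v * q -> q * v = g -> g * g = g -> g = 0.
Proof.
move=> Dq Uv qv <- gg; have [w [_ w1]] := Dq _ Uv qv.
by rewrite -[LHS]mul1r -w1 -mulrA mulrBl mul1r gg subrr mulr0.
Qed.

(** Writing [u = e + q], the idempotent [e = u - q] equals [u (1 - u^-1 q)],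
    hence is a unit, hence is [1]. *)
Lemma unit_sub1_Delta_nilpotent u :
  strongly_Delta_nil_clean R -> units u -> Delta_nilpotents (u - 1).
Proof.
move=> clean [v [uv vu]]; have [e [q [ue e2 eq Dq]]] := clean u.
have qu : q * u = u * q by rewrite ue mulrDl mulrDr eq.
have qv := commute_unit_inv uv vu qu.
have Uv : units v by exists u.
have [w [w1 _]] := Dq _ Uv qv.
suff e1 : e = 1 by rewrite ue e1 addrC addKr.
have ew : e * (v * w) = 1.
  by rewrite mulrA -w1 -uv -mulrBl ue addrK.
by rewrite -[LHS]mulr1 -[in LHS]ew mulrA -expr2 e2 ew.
Qed.

(** The exchange property: a left ideal outside the radical contains a nonzero
    idempotent. If [1 - s x] is not left invertible and [s x = f + q], then
    [f s x = f (1 + q)] with [1 + q] a unit, so that [f] is a left multiple of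
    [x]; and [f = 0] would make [1 - s x = 1 - q] a unit. *)
Lemma exchange_idempotent x :
  strongly_Delta_nil_clean R -> ~ jacobson_radical x ->
  exists e r, [/\ e * e = e, e <> 0, r * x = e & e * r = r].
Proof.
move=> clean /jacobson_radicalP/existsNP[s sNinv].
have [f [q [sx f2 fq Dq]]] := clean (s * x).
have [p [qp pq]] := Delta_nilpotent_unitD Dq.
have fp : f * p = p * f.
  by apply: (commute_unit_inv qp pq); rewrite mulrDr mulrDl mulr1 mul1r fq.
have ff : f * f = f by rewrite -expr2.
exists f, (p * f * s); split=> //.
- move=> f0; apply: sNinv; rewrite sx f0 add0r.
  by have [c [_ c1]] := Delta_nilpotent_unitB Dq; exists c.
- rewrite -mulrA sx -mulrA mulrDr ff fq -[X in X + _]mul1r -mulrDl.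
  by rewrite mulrA pq mul1r.
- by rewrite !mulrA fp -(mulrA p) ff.
Qed.

(** The elements [e], [a], [b], [a b] are the units [e11], [e21], [e12], [e22]
    of a 2 x 2 matrix ring with identity [g = e + a b]. The Fibonacci matrix
    with rows (1, 1), (1, 0) is [g + q] for [q = a + b - a b], and its inverse
    is [q]. Completing it by [1 - g] to the unit [1 + q] of the whole ring
    gives [q (1 + q) = g], so [g = 0]. *)
Lemma no_matrix_units e a b : strongly_Delta_nil_clean R ->
  e * e = e -> a * e = a -> e * a = 0 -> e * b = b -> b * e = 0 -> b * a = e ->
  e = 0.
Proof.
move=> clean ee ae ea eb be ba.
pose c := a * b; pose q := a + b - c; pose g := e + c.
have aa : a * a = 0 by rewrite -{1}ae -mulrA ea mulr0.
have bb : b * b = 0 by rewrite -{2}eb mulrA be mul0r.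
have ac : a * c = 0 by rewrite mulrA aa mul0r.
have bc : b * c = b by rewrite mulrA ba eb.
have ca : c * a = a by rewrite -mulrA ba ae.
have cb : c * b = 0 by rewrite -mulrA bb mulr0.
have cc : c * c = c by rewrite mulrA ca.
have ec : e * c = 0 by rewrite mulrA ea mul0r.
have ce : c * e = 0 by rewrite -mulrA be mulr0.
have qq : q * q = g - q.
  rewrite !(mulrDl, mulrDr, mulrN, mulNr) aa ba ca bb cb ac bc cc -/c.
  rewrite !(subr0, addr0, add0r) opprK (addrA c) (addrC c e) -(addrA (e + c)).
  by rewrite opprB opprD (addrC (- b)) (addrC (- a)) (addrA c).
have gq : g * q = q.
  rewrite !(mulrDl, mulrDr, mulrN, mulNr) ea eb ec ca cb cc.
  by rewrite subr0 add0r addr0 addrCA addrA.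
have qg : q * g = q.
  rewrite !(mulrDl, mulrDr, mulrN, mulNr) ae be ce ac bc cc.
  by rewrite !(oppr0, addr0, add0r).
have gg : g * g = g.
  by rewrite !(mulrDl, mulrDr) ee ec ce cc addr0 add0r.
have eg : e * g = e by rewrite mulrDr ee ec addr0.
clearbody q g.
have Uq : units (1 + q).
  exists (1 - g + q); split.
    rewrite mulrDr !mulrDl !mul1r mulrBr mulr1 qg subrr addr0 qq.
    by rewrite (addrC q) !subrK.
  rewrite mulrDl mulrBl mul1r !mulrDr !mulr1 gq qq.
  by rewrite (addrC q (g - q)) subrK (addrC g q) addrKA subrK.
have Dq : Delta_nilpotents q.
  by have := unit_sub1_Delta_nilpotent clean Uq; rewrite addrC addKr.
have g0 : g = 0.
  apply: (Delta_nilpotent_idempotent Dq Uq) => //.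
    by rewrite mulrDl mulrDr mulr1 mul1r.
  by rewrite mulrDr mulr1 qq addrC subrK.
by rewrite -eg g0 mulr0.
Qed.

(** If [x] is not in the radical, then [e = r x] for some idempotent [e <> 0];
    as [e x = r x x = 0], the elements [x e] and [r (1 - e)] complete [e] to
    2 x 2 matrix units. *)
Lemma square_zero_jacobson x :
  strongly_Delta_nil_clean R -> x * x = 0 -> jacobson_radical x.
Proof.
move=> clean xx; apply: contrapT => /(exchange_idempotent clean).
move=> [e [r [ee e0 rx er]]]; apply: e0.
have ex : e * x = 0 by rewrite -rx -mulrA xx mulr0.
apply: (@no_matrix_units e (x * e) (r * (1 - e))) => //.
- by rewrite -mulrA ee.
- by rewrite mulrA ex mul0r.
- by rewrite mulrA er.
- by rewrite -mulrA mulrBl mul1r ee subrr mulr0.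
- by rewrite mulrA -(mulrA r) mulrBl mul1r ex subr0 rx ee.
Qed.

(** [e y (1 - e)] has square zero. With [e] and [1 - e] exchanged as well, this
    says that idempotents are central modulo the radical. *)
Lemma peirce_jacobson e y : strongly_Delta_nil_clean R -> e * e = e ->
  jacobson_radical (e * y * (1 - e)).
Proof.
move=> clean ee; apply: square_zero_jacobson => //.
by rewrite !mulrA -(mulrA _ (1 - e)) mulrBl mul1r ee subrr mulr0 !mul0r.
Qed.

(** The idempotent [p = 1 - b a] satisfies [p b = 0], whence
    [p = p a b = p a (1 - p) b]. This lies in the radical because [p] is central
    modulo the radical, and the radical contains no nonzero idempotent. *)
Lemma dedekind_finite a b : strongly_Delta_nil_clean R ->
  a * b = 1 -> b * a = 1.
Proof.
move=> clean ab; pose p := 1 - b * a.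
have pb : p * b = 0 by rewrite mulrBl mul1r -mulrA ab mulr1 subrr.
have pp : p * p = p by rewrite {2}/p mulrBr mulr1 mulrA pb mul0r subr0.
suff p0 : p = 0 by apply/esym/eqP; rewrite -subr_eq0 -/p p0.
apply: jacobson_radical_idempotent => //.
have -> : p = p * a * (1 - p) * b.
  by rewrite -!mulrA [(1 - p) * b]mulrBl mul1r pb subr0 ab mulr1.
by apply: jacobson_radicalMr; exact: peirce_jacobson.
Qed.

(** As idempotents are central modulo the radical, [e c e + 1 - e] is a left
    inverse of [e d e + 1 - e] modulo the radical. *)
Lemma corner_unit e c d : strongly_Delta_nil_clean R -> e * e = e ->
  e * c * d * e = e -> units (1 - e + e * d * e).
Proof.
move=> clean ee cd; pose f := 1 - e.
have ef : e * f = 0 by rewrite mulrBr mulr1 ee subrr.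
have fe : f * e = 0 by rewrite mulrBl mul1r ee subrr.
have ff : f * f = f by rewrite [LHS]mulrBl mul1r ef subr0.
have ef1 : e + f = 1 by rewrite addrC subrK.
have Jf y : jacobson_radical (e * y * f) by exact: peirce_jacobson.
rewrite -/f; clearbody f; pose j := e * c * f * d * e.
have [w [_ w1]] : units (1 - j).
  by apply: jacobson_radical_unit; do 2!apply: jacobson_radicalMr.
have jE : e * c * e * d * e = e - j.
  by apply: (addIr j); rewrite subrK -!mulrDl -mulrDr ef1 mulr1 cd.
have cdj : (f + e * c * e) * (f + e * d * e) = 1 - j.
  rewrite mulrDl !mulrDr ff !mulrA fe !mul0r -(mulrA _ e f) ef mulr0 addr0 add0r.
  by rewrite -(mulrA _ e e) ee jE -ef1 addrCA addrA.
exists (w * (f + e * c * e)).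
suff wc : w * (f + e * c * e) * (f + e * d * e) = 1.
  by split=> //; exact: dedekind_finite clean wc.
by rewrite -mulrA cdj.
Qed.

(** Let [q = u - 1] lie outside the radical and [e = r q] be a nonzero
    idempotent. In the corner of [e] both [e u e] and [e q e] are invertible,
    by the previous lemma; so [e q e] is of the form unit minus one and divides
    [e] through a unit. *)
Lemma unit_sub1_jacobson u :
  strongly_Delta_nil_clean R -> units u -> jacobson_radical (u - 1).
Proof.
move=> clean [u' [uu' u'u]]; apply: contrapT => /(exchange_idempotent clean).
set q := u - 1; move=> [e [r [ee e0 rq er]]]; apply: e0.
pose Q := e * q * e; pose V := 1 - e + Q.
have Q1 : 1 - e + e * u * e = 1 + Q.
  by rewrite /Q mulrBr mulr1 mulrBl ee addrA addrAC.
have DQ : Delta_nilpotents Q.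
  rewrite -[Q](addKr 1) addrC; apply: unit_sub1_Delta_nilpotent => //.
  rewrite -Q1; apply: (corner_unit (c := u')) => //.
  by rewrite -(mulrA e) u'u mulr1.
have [W [VW WV]] : units V.
  by apply: (corner_unit (c := r)); rewrite // er rq.
have eQ : e * Q = Q by rewrite !mulrA ee.
have Qe : Q * e = Q by rewrite -mulrA ee.
have eV : e * V = Q by rewrite mulrDr mulrBr mulr1 ee subrr add0r eQ.
have QV : Q * V = V * Q.
  by rewrite mulrDr mulrDl mulrBr mulrBl mulr1 mul1r eQ Qe.
apply: (Delta_nilpotent_idempotent DQ (v := W)) => //; first by exists V.
- exact: commute_unit_inv QV.
- by rewrite -eV -mulrA VW mulr1.
Qed.

Lemma Delta_sub_jacobson : strongly_Delta_nil_clean R ->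
  @Delta_nilpotents R `<=` @jacobson_radical R.
Proof.
move=> clean q /Delta_nilpotent_unitD /(unit_sub1_jacobson clean).
by rewrite addrC addKr.
Qed.

End DeltaNilpotent.

Theorem theorem5p3 (R : pzRingType) :
  [<-> strongly_J_clean R;
       strongly_quasi_nil_clean R;
       strongly_Delta_nil_clean R].
Proof.
tfae.
- exact/strong_decomposition_sub/jacobson_sub_quasi_nilpotents.
- exact/strong_decomposition_sub/quasi_sub_Delta_nilpotents.
- by move=> clean; exact: strong_decomposition_sub (Delta_sub_jacobson clean) clean.
Qed.
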